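(* Let $N=(G=(V,E),\sigma,u,s)$ be a skew-symmetric network in which no arc enters $s$. Then every maximum IS-flow in $N$ is an optimal solution of the linear program: maximize $\sum_{a\text{ leaving }s}f(a)$ over $f\in\mathbb R^E$ subject to $0\le f(a)\le u(a)$ for all $a\in E$; $\sum_{a\text{ leaving }v}f(a)-\sum_{a\text{ entering }v}f(a)=0$ for all $v\in V\setminus\{s,s'\}$; and $\sum_{a\in E}f(a)\chi_\rho(a)\le 2u(U_\rho)-2$ for every odd fragment $\rho=(V_\rho,U_\rho)$. (In particular, this LP has no symmetry or integrality constraints, and its optimum value equals the maximum IS-flow value.)
   Context: A skew-symmetric graph is a finite directed graph $G=(V,E)$ (parallel arcs allowed) with a map $\sigma$ of $V\cup E$ onto itself such that $\sigma(x)\ne x$, $\sigma(\sigma(x))=x$ for all $x$, $\sigma(V)=V$, and for each arc $a$ from $v$ to $w$, $\sigma(a)$ is an arc from $\sigma(w)$ to $\sigma(v)$. A function on $E$ is symmetric if it takes equal values on $a$ and $\sigma(a)$. A skew-symmetric network is $N=(G,\sigma,u,s)$ with $u:E\to\mathbb Z_{\ge0}$ symmetric and source $s$; $s'=\sigma(s)$. A flow is $f:E\to\mathbb R_{\ge0}$ with $f\le u$ and conservation at nodes other than $s,s'$; an IS-flow is an integer-valued symmetric flow, and a maximum IS-flow is one of maximum value (net outflow at $s$). For $S\subseteq E$, $u(S)=\sum_{a\in S}u(a)$. An odd fragment is a pair $\rho=(V_\rho,U_\rho)$ where $V_\rho\subseteq V$ is self-symmetric ($\sigma(V_\rho)=V_\rho$),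 $s\notin V_\rho$, and $U_\rho$ is a set of arcs entering $V_\rho$ with $u(U_\rho)$ odd. Its characteristic function $\chi_\rho:E\to\{-1,0,1\}$ is $\chi_\rho(a)=1$ if $a\in U_\rho\cup\sigma(U_\rho)$, $\chi_\rho(a)=-1$ if $a\in\delta(V_\rho)\setminus(U_\rho\cup\sigma(U_\rho))$, and $0$ otherwise, where $\delta(V_\rho)$ is the set of arcs with exactly one end in $V_\rho$. *)

(* Defs.v *)
From mathcomp Require Import all_boot all_order all_algebra.
Set Implicit Arguments. Unset Strict Implicit. Unset Printing Implicit Defensive.
Import Order.TTheory GRing.Theory Num.Theory.
Local Open Scope ring_scope.

(* A directed multigraph: finite node type V, finite arc type E, each arc a
   goes from [tl a] to [hd a].  [sv], [se] are the skew-symmetry map on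
   nodes and on arcs respectively. *)
Definition skew_symmetric (V E : finType) (tl hd : E -> V)
    (sv : V -> V) (se : E -> E) : Prop :=
  [/\ (forall v, sv v != v), involutive sv,
      (forall a, se a != a), involutive se &
      (forall a, tl (se a) = sv (hd a) /\ hd (se a) = sv (tl a))].

Definition sym_cap (E : finType) (se : E -> E) (u : E -> nat) : Prop :=
  forall a, u (se a) = u a.

Definition netout (V E : finType) (tl hd : E -> V) (R : numDomainType)
    (f : E -> R) (v : V) : R :=
  \sum_(a | tl a == v) f a - \sum_(a | hd a == v) f a.

Definition is_flow (V E : finType) (tl hd : E -> V) (sv : V -> V)
    (u : E -> nat) (s : V) (R : numDomainType) (f : E -> R) : Prop :=
  (forall a, 0 <= f a <= (u a)%:R) /\
  (forall v, v != s -> v != sv s -> netout tl hd f v = 0).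

Definition is_ISflow (V E : finType) (tl hd : E -> V) (sv : V -> V)
    (se : E -> E) (u : E -> nat) (s : V) (g : E -> int) : Prop :=
  (forall a, g (se a) = g a) /\ is_flow tl hd sv u s g.

Definition is_max_ISflow (V E : finType) (tl hd : E -> V) (sv : V -> V)
    (se : E -> E) (u : E -> nat) (s : V) (g : E -> int) : Prop :=
  is_ISflow tl hd sv se u s g /\
  forall g', is_ISflow tl hd sv se u s g' ->
    netout tl hd g' s <= netout tl hd g s.

Definition capS (E : finType) (u : E -> nat) (S : {set E}) : nat :=
  \sum_(a in S) u a.

Definition odd_fragment (V E : finType) (tl hd : E -> V) (sv : V -> V)
    (u : E -> nat) (s : V) (Vr : {set V}) (Ur : {set E}) : Prop :=
  [/\ sv @: Vr = Vr, s \notin Vr,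
      (forall a, a \in Ur -> (hd a \in Vr) && (tl a \notin Vr)) &
      odd (capS u Ur)].

Definition chi (V E : finType) (tl hd : E -> V) (se : E -> E)
    (Vr : {set V}) (Ur : {set E}) (a : E) : int :=
  if a \in Ur :|: se @: Ur then 1
  else if (hd a \in Vr) != (tl a \in Vr) then -1 else 0.

Definition LP_feasible (V E : finType) (tl hd : E -> V) (sv : V -> V)
    (se : E -> E) (u : E -> nat) (s : V) (R : numDomainType) (f : E -> R) : Prop :=
  is_flow tl hd sv u s f /\
  forall (Vr : {set V}) (Ur : {set E}), odd_fragment tl hd sv u s Vr Ur ->
    \sum_a f a * (chi tl hd se Vr Ur a)%:~R <= 2 * (capS u Ur)%:R - 2.

Definition LP_obj (V E : finType) (tl : E -> V) (s : V) (R : numDomainType)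
    (f : E -> R) : R := \sum_(a | tl a == s) f a.

(* Main.v *)
Require Import Defs.
From mathcomp Require Import all_boot all_order all_algebra.
From mathcomp Require Import boolp reals.
From mathcomp Require Import zify ring.
Set Implicit Arguments. Unset Strict Implicit. Unset Printing Implicit Defensive.
Import Order.TTheory GRing.Theory Num.Theory.

(** If g is a maximum IS-flow, its residual network has no regular walk from s
    to s', that is, no walk of residual arcs containing both an arc of residual
    capacity 1 and its mate: pushing a unit along such a walk and along its dual
    would gain 2.  Let A be the set of nodes v such that v is reached by a
    regular walk and v' is not, and Z the set of those such that both are.  A
    residual arc leaving A ends in A or is a "gate", an arc from A to Z, of
    capacity 1.  If b is a gate, every regular walk to a node of the component
    of Z entered by b goes through b, hence distinct gates enter distinct
    components.  The components X of Z, with the arcs from A to X, are then odd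
    fragments whose constraints are tight for g, and together with the capacity
    constraints they certify that g is optimal: if phi is 1 on A, -1 on A' and 0
    elsewhere, the functional sum_v phi(v) netout(v), twice the value, minus the
    sum of the fragment functionals has a coefficient <= 0 on every arc with
    g < u and >= 0 on every arc with g > 0. *)

(** * Regular reachability *)

Section RegularReachability.

Variables (V E : finType) (t h : E -> V) (sv : V -> V) (se : E -> E).
Variables (c : E -> nat) (s : V).
Hypothesis Hskew : skew_symmetric t h sv se.
Hypothesis Hc : sym_cap se c.

Let svK : involutive sv. Proof. by case: Hskew. Qed.
Let seK : involutive se. Proof. by case: Hskew. Qed.
Let se_neq a : se a != a. Proof. by case: Hskew. Qed.
Let t_se a : t (se a) = sv (h a).
Proof. by case: Hskew => _ _ _ _ /(_ a) []. Qed.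
Let h_se a : h (se a) = sv (t a).
Proof. by case: Hskew => _ _ _ _ /(_ a) []. Qed.

Fixpoint walk (x : V) (p : seq E) (y : V) : bool :=
  if p is e :: p' then (t e == x) && walk (h e) p' y else x == y.

Lemma walk_cat_cons x p e q y :
  walk x (p ++ e :: q) y = walk x p (t e) && walk (h e) q y.
Proof.
elim: p x => [|a p IH] x /=; first by rewrite eq_sym.
by rewrite IH andbA.
Qed.

Lemma walk_cat x p z q y : walk x p z -> walk z q y -> walk x (p ++ q) y.
Proof.
elim: p x => [|a p IH] x /=; first by move/eqP->.
by move=> /andP[-> /IH{}IH] /IH.
Qed.

Lemma walk_rcons x p e y : walk x (rcons p e) y = walk x p (t e) && (h e == y).
Proof. by rewrite -cats1 walk_cat_cons. Qed.

Definition dual_walk (p : seq E) : seq E := rev (map se p).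

Lemma mem_dual p e : (e \in dual_walk p) = (se e \in p).
Proof. by rewrite mem_rev -{1}(seK e) mem_map //; exact: inv_inj. Qed.

Lemma walk_dual x p y : walk x p y -> walk (sv y) (dual_walk p) (sv x).
Proof.
elim: p x => [|a p IH] x /=; first by move/eqP->.
move=> /andP[/eqP<- /IH Hw]; rewrite /dual_walk map_cons rev_cons walk_rcons.
by rewrite t_se Hw h_se eqxx.
Qed.

(* Every arc has positive capacity, and an arc of capacity 1 does not occur
   together with its mate. *)
Definition regular (p : seq E) : bool := all (fun e => (se e \in p) < c e) p.

Lemma regular_sub p q : {subset q <= p} -> regular p -> regular q.
Proof.
move=> qp /allP Hp; apply/allP => e eq; apply: leq_ltn_trans (Hp e (qp _ eq)).
by case: (boolP (se e \in q)) => // /qp ->.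
Qed.

Lemma regular_dual p : regular p -> regular (dual_walk p).
Proof.
move=> /allP Hp; apply/allP => e; rewrite !mem_dual => /Hp.
by rewrite Hc.
Qed.

Lemma regular_cat p q :
  regular p -> regular q -> (forall e, e \in p -> se e \notin q) ->
  regular (p ++ q).
Proof.
move=> /allP Hp /allP Hq pq; apply/allP => e; rewrite !mem_cat.
case/orP => ein.
  by rewrite (negPf (pq _ ein)) orbF Hp.
case: (boolP (se e \in p)) => [sp|_]; last exact: Hq.
by have := pq _ sp; rewrite seK ein.
Qed.

Lemma regular_rcons p e : regular p -> (se e \in p) < c e -> regular (rcons p e).
Proof.
move=> /allP Hp He; apply/allP => a.
rewrite !mem_rcons !inE => /orP[/eqP->|ap].
  by rewrite (negPf (se_neq e)).
case: (eqVneq (se a) e) => [sae|_] /=; last exact: Hp.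
by rewrite -Hc sae; move: He; rewrite -sae seK ap.
Qed.

Definition rwalk p y := walk s p y && regular p.
Definition reach y := exists p, rwalk p y.

Lemma rwalk_prefix p e q y : rwalk (p ++ e :: q) y -> rwalk p (t e).
Proof.
move=> /andP[]; rewrite walk_cat_cons => /andP[wp _] rp.
rewrite /rwalk wp; apply: regular_sub rp => a; rewrite mem_cat => -> //.
Qed.

Lemma rwalk_prefix_rcons p e q y : rwalk (p ++ e :: q) y -> rwalk (rcons p e) (h e).
Proof.
move=> /andP[]; rewrite walk_cat_cons => /andP[wp _] rp.
rewrite /rwalk walk_rcons wp eqxx; apply: regular_sub rp => a.
by rewrite mem_rcons inE mem_cat inE => /orP[->|->]; rewrite ?orbT.
Qed.

Lemma rwalk_first b p y :
  rwalk p y -> b \in p -> exists2 q, rwalk (rcons q b) (h b) & b \notin q.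
Proof.
move=> rp bp; exists (take (index b p) p); last first.
  by rewrite in_take_leq ?index_size // ltnn.
have pE : p = take (index b p) p ++ b :: drop (index b p).+1 p.
  by rewrite -[X in X = _](cat_take_drop (index b p) p) (drop_nth b) ?index_mem // nth_index.
by move: rp; rewrite {1}pE; exact: rwalk_prefix_rcons.
Qed.

Lemma rwalk_step p e :
  rwalk p (t e) -> (se e \in p) < c e -> rwalk (rcons p e) (h e).
Proof.
by move=> /andP[wp rp] He; rewrite /rwalk walk_rcons wp eqxx regular_rcons.
Qed.

(* Follow [R] up to its first arc lying on [T] or on the dual of [T], then
   switch to that walk. *)
Lemma splice R x T y :
  rwalk R x -> walk x T y -> regular T ->
  exists2 W, rwalk W y \/ rwalk W (sv x) &
    {subset W <= R ++ T ++ dual_walk T}.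
Proof.
move=> /andP[wR rR] wT rT.
case: (boolP (has [in T ++ dual_walk T] R)) => [hR|/hasPn Hn]; last first.
  exists (R ++ T); last by move=> e; rewrite !mem_cat orbA => ->.
  left; rewrite /rwalk (walk_cat wR wT) regular_cat // => e /Hn /=.
  by rewrite mem_cat negb_or mem_dual => /andP[].
move: wR rR; case/split_find: hR => e R1 R2 eT /hasPn Hn.
rewrite {1}cat_rcons walk_cat_cons => /andP[wR1 _] rR.
have rR1 : regular R1.
  by apply: regular_sub rR => a ain; rewrite cat_rcons mem_cat ain.
(* [U] stands for whichever of [T] and its dual contains [e]. The arcs of [R1] avoid both, so [R1]
   followed by [U] from [e] onwards stays regular. *)
have main U z : e \in U -> regular U ->
    {subset U <= T ++ dual_walk T} ->
    (forall a, se a \in U -> a \in T ++ dual_walk T) ->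
    (exists v, walk v U z) ->
    exists2 W, rwalk W z & {subset W <= rcons R1 e ++ R2 ++ T ++ dual_walk T}.
  move=> eU rU UT sUT [v wU].
  case/splitPr: eU wU rU UT sUT => U1 U2; rewrite walk_cat_cons.
  move=> /andP[_ wU2] rU UT sUT; exists (R1 ++ e :: U2).
    rewrite /rwalk walk_cat_cons wR1 wU2 regular_cat //.
      by apply: regular_sub rU => a ain; rewrite mem_cat ain orbT.
    move=> a /Hn /=; apply: contra => ain; apply: sUT.
    by rewrite mem_cat ain orbT.
  move=> a; rewrite !mem_cat mem_rcons !inE => /or3P[->||aU2]; rewrite ?orbT //.
    by move->.
  have := UT a; rewrite !mem_cat inE aU2 !orbT => /(_ isT) ->.
  by rewrite !orbT.
have sub W : {subset W <= rcons R1 e ++ R2 ++ T ++ dual_walk T} ->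
    {subset W <= (rcons R1 e ++ R2) ++ T ++ dual_walk T}.
  by move=> H a /H; rewrite !mem_cat !orbA.
move: (eT); rewrite /= mem_cat => /orP[eiT|eiT].
  have [] := main T y eiT rT.
  - by move=> a; rewrite mem_cat => ->.
  - by move=> a; rewrite mem_cat mem_dual orbC => ->.
  - by exists x.
  by move=> W rW sW; exists W; [left | apply: sub].
have [] := main (dual_walk T) (sv x) eiT (regular_dual rT).
- by move=> a; rewrite mem_cat orbC => ->.
- by move=> a; rewrite mem_cat !mem_dual seK => ->.
- by exists (sv y); apply: walk_dual.
by move=> W rW sW; exists W; [right | apply: sub].
Qed.

Lemma split_last (b : E) p :
  b \in p -> exists p1 p2, p = p1 ++ b :: p2 /\ b \notin p2.
Proof.
elim: p => // a p IH; rewrite inE; case: (boolP (b \in p)) => [bp _|bp].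
  by have [p1 [p2 [-> Hb]]] := IH bp; exists (a :: p1), p2.
by rewrite orbF => /eqP <-; exists [::], p.
Qed.

Hypothesis no_rwalk : ~ reach (sv s).

Lemma reach_s : reach s.
Proof. by exists [::]; rewrite /rwalk /= eqxx. Qed.

(** Appending [e] to [p] fails only if [c e = 1] and [se e] lies on [p]; the part of [p] before
    [se e] then ends at [sv (h e)]. *)
Lemma reach_step e p :
  rwalk p (t e) -> 0 < c e -> ~ reach (h e) ->
  [/\ c e = 1, se e \in p & reach (sv (h e))].
Proof.
move=> rp ce nh.
case: (ltnP (se e \in p) (c e)) => [/(rwalk_step rp) rh|].
  by case: nh; exists (rcons p e).
case: (boolP (se e \in p)) => [ep|_]; last by rewrite leqNgt ce.
move=> c1; split => //; first by apply/eqP; rewrite eqn_leq c1.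
case/splitPr: ep rp => p1 p2 /rwalk_prefix; rewrite t_se.
by exists p1.
Qed.

(** * The sets A and Z, and the gates between them *)

Definition inA v := `[< reach v /\ ~ reach (sv v) >].
Definition inZ v := `[< reach v /\ reach (sv v) >].

Lemma inZ_sv v : inZ (sv v) = inZ v.
Proof. by apply/asboolP/asboolP; rewrite svK => -[]. Qed.

(** Otherwise [se e] lies on the walk to [t e], and the part of that walk up to and including [se e]
    reaches [sv (t e)]. *)
Lemma A_out e : inA (t e) -> 0 < c e -> reach (h e).
Proof.
move=> /asboolP[[p rp] nr] ce; apply: contrapT => nh.
have [c1 ep _] := reach_step rp ce nh; apply: nr.
case/splitPr: ep rp => p1 p2 /andP[].
rewrite walk_cat_cons => /andP[w1 _] rg; exists (rcons p1 (se e)).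
rewrite /rwalk walk_rcons w1 h_se eqxx /=; apply: regular_sub rg => a.
by rewrite mem_rcons inE mem_cat inE => /orP[->|->]; rewrite ?orbT.
Qed.

Definition gate b := [&& 0 < c b, inA (t b) & inZ (h b)].

(** The mate of [b] starts at [sv (h b)] and ends at [sv (t b)], which is not reached, so
    [reach_step] applies to it. *)
Lemma gateP b p : gate b -> rwalk p (sv (h b)) -> c b = 1 /\ b \in p.
Proof.
move=> /and3P[cb /asboolP[ra na] /asboolP[rz nz]] rp.
have := @reach_step (se b) p; rewrite t_se h_se Hc seK.
by case=> // -> ->.
Qed.

Lemma gate_cap b : gate b -> c b = 1.
Proof.
move=> gb; have /and3P[_ _ /asboolP[_ [p rp]]] := gb.
by have [] := gateP gb rp.
Qed.

Definition crit b v := forall p, rwalk p v \/ rwalk p (sv v) -> b \in p.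

Lemma crit_sv b v : crit b v -> crit b (sv v).
Proof. by move=> H p; rewrite svK => -[] Hp; apply: H; [right|left]. Qed.

(** Cut [p] after the last occurrence of [b]; the mate of [b] is absent from [p] because
    [c b = 1]. *)
Lemma gate_tail b p v :
  gate b -> rwalk p v -> b \in p ->
  exists T, [/\ walk (h b) T v, regular T, b \notin T & b \notin dual_walk T].
Proof.
move=> gb /andP[wp rp] bp.
have [p1 [p2 [pE b2]]] := split_last bp; exists p2; subst p.
move: wp; rewrite walk_cat_cons => /andP[_ w2].
have sp : {subset p2 <= p1 ++ b :: p2}.
  by move=> a ain; rewrite mem_cat inE ain !orbT.
split => //; first exact: regular_sub rp.
rewrite mem_dual; apply/negP => /sp sb.
by move/allP: rp => /(_ b bp); rewrite sb gate_cap.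
Qed.

(** Walks to [sv (h b)] are covered by [gateP]. If [R] reached [h b] without [b], splicing it with
    the tail after [b] of a walk to [sv (h b)] would reach [sv (h b)] without [b], whichever end the
    splice takes. *)
Lemma crit_gate b : gate b -> crit b (h b).
Proof.
move=> gb R [rR|rR]; last by have [] := gateP gb rR.
apply: contrapT => /negP bR.
have /and3P[_ _ /asboolP[_ [S rS]]] := gb.
have [_ bS] := gateP gb rS.
have [T [wT rT bT bT']] := gate_tail gb rS bS.
have [W HW sW] := splice rR wT rT.
have [_ /sW] : c b = 1 /\ b \in W by apply: gateP => //; case: HW.
by rewrite !mem_cat (negPf bR) (negPf bT) (negPf bT').
Qed.

Lemma crit_arc b e :
  gate b -> 0 < c e -> crit b (t e) -> inZ (h e) -> crit b (h e).
Proof.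
move=> gb ce cv /asboolP[rw rw'].
(* Either [se e] extends [p] to [sv (t e)], and [b] is not [se e] since [h e] is reached, or [e]
   lies on [p] and the part before it reaches [t e]. *)
have crit' p : rwalk p (sv (h e)) -> b \in p.
  move=> rp; apply: contrapT => /negP bp.
  case: (ltnP (e \in p) (c e)) => [ep|].
    have : rwalk (rcons p (se e)) (sv (t e)).
      by rewrite -h_se; apply: rwalk_step; rewrite ?t_se // seK Hc.
    move=> rp'; have := cv _ (or_intror rp').
    rewrite mem_rcons inE (negPf bp) orbF => /eqP bE.
    have /and3P[_ _ /asboolP[_]] := gb; rewrite bE h_se svK.
    have /and3P[_ /asboolP[_]] := gb; rewrite bE t_se svK //.
  case: (boolP (e \in p)) => [ep _|_]; last by rewrite leqNgt ce.
  case/splitPr: ep rp bp => p1 p2 /rwalk_prefix rp.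
  by rewrite mem_cat (cv _ (or_introl rp)).
move=> R [rR|]; last exact: crit'.
(* The dual of the tail after [b] runs from [h e] to [sv (h b)]. Splicing [R] with it yields a walk
   without [b] to [sv (h b)] or to [sv (h e)], against [gateP] or [crit']. *)
apply: contrapT => /negP bR.
have [S rS] := rw'; have bS := crit' _ rS.
have [T [wT rT bT bT']] := gate_tail gb rS bS.
have := walk_dual wT; rewrite svK => wT'.
have [W HW sW] := splice rR wT' (regular_dual rT).
have /sW : b \in W.
  case: HW => [rW|]; last exact: crit'.
  by have [] := gateP gb rW.
rewrite !mem_cat (negPf bR) (negPf bT') !mem_dual seK (negPf bT) //.
Qed.

(** Joining each node to its mate makes the components self-symmetric, as odd fragments must be. *)
Definition adj v w := [&& inZ v, inZ w & (w == sv v) ||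
  [exists e, (0 < c e) && ((t e == v) && (h e == w) || (t e == w) && (h e == v))]].

Lemma adj_sym : symmetric adj.
Proof.
move=> v w; rewrite /adj andbCA; congr [&& _, _ & _ || _].
  by apply/eqP/eqP => ->; rewrite svK.
by apply: eq_existsb => e; rewrite orbC.
Qed.

Lemma crit_adj b v w : gate b -> adj v w -> crit b v -> crit b w.
Proof.
move=> gb /and3P[zv zw] /orP[/eqP->|]; first exact: crit_sv.
move=> /existsP[e /andP[ce /orP[] /andP[/eqP te /eqP he]]] cv.
  by rewrite -he; apply: crit_arc; rewrite ?te ?he.
(* An arc from [w] to [v] is replaced by its mate, which goes from [sv v] to [sv w]. *)
rewrite -[w]svK; apply: crit_sv; rewrite -te -h_se.
by apply: crit_arc; rewrite ?Hc ?t_se ?h_se ?he ?te ?inZ_sv //; exact: crit_sv.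
Qed.

Definition comp b := [set v | inZ v & connect adj (h b) v].

Lemma crit_connect b v w : gate b -> connect adj v w -> crit b v -> crit b w.
Proof.
move=> gb /connectP[p]; elim: p v => [|x p IH] v /=; first by move=> _ ->.
by move=> /andP[/(crit_adj gb) vx /IH{}IH] /IH{}IH /vx.
Qed.

Lemma adj_connect_sym : connect_sym adj.
Proof. exact: sym_connect_sym adj_sym. Qed.

Lemma comp_gate b : gate b -> h b \in comp b.
Proof. by move=> /and3P[_ _ zb]; rewrite inE zb connect0. Qed.

Lemma comp_sv b v : (sv v \in comp b) = (v \in comp b).
Proof.
rewrite !inE inZ_sv; case: (boolP (inZ v)) => //= zv.
apply: same_connect_r adj_connect_sym _ _ _ _.
by apply: connect1; rewrite /adj inZ_sv zv svK eqxx.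
Qed.

Lemma comp_step b v w :
  v \in comp b -> inZ w ->
  (exists2 e, 0 < c e & t e = v /\ h e = w) -> w \in comp b.
Proof.
rewrite !inE => /andP[zv bv] zw [e ce [te he]]; rewrite zw.
apply: connect_trans bv (connect1 _); rewrite /adj zv zw.
by apply/orP; right; apply/existsP; exists e; rewrite ce te he !eqxx.
Qed.

(** If the components meet, each gate is critical for the head of the other. A walk stopped at its
    first [b] must already contain [b']; stopped there, it reaches [h b'] without [b]. *)
Lemma comp_inj b b' v :
  gate b -> gate b' -> v \in comp b -> v \in comp b' -> b = b'.
Proof.
move=> gb gb'; rewrite !inE => /andP[_ bv] /andP[_ b'v].
have bb' : connect adj (h b) (h b').
  by apply: connect_trans bv _; rewrite adj_connect_sym.
have c1 : crit b (h b') := crit_connect gb bb' (crit_gate gb).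
have c2 : crit b' (h b).
  by apply: crit_connect (crit_gate gb'); rewrite // adj_connect_sym.
apply/eqP; apply: contrapT => /negP nbb'.
have /and3P[_ _ /asboolP[[p rp] _]] := gb.
have [q rq bq] := rwalk_first rp (crit_gate gb (or_introl rp)).
have := c2 _ (or_introl rq); rewrite mem_rcons inE eq_sym (negPf nbb') /= => b'q.
case/splitPr: b'q rq bq => q1 q2; rewrite rcons_cat => /rwalk_prefix_rcons rq1.
have := c1 _ (or_introl rq1); rewrite mem_rcons inE (negPf nbb') /= => bq1.
by rewrite mem_cat bq1.
Qed.

(* The sets [X b] are the components entered by the gates [B]. *)
Record barrier (A : {set V}) (B : pred E) (X : E -> {set V}) : Prop := Barrier {
  barrier_s : s \in A;
  barrier_dual : forall v, v \in A -> sv v \notin A;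
  barrier_cap : forall b, B b -> c b = 1;
  barrier_tail : forall b, B b -> t b \in A;
  barrier_head : forall b, B b -> h b \in X b;
  barrier_sv : forall b v, (sv v \in X b) = (v \in X b);
  barrier_disj : forall b v, v \in X b -> v \notin A;
  barrier_inj : forall b b' v, B b -> B b' -> v \in X b -> v \in X b' -> b = b';
  barrier_out : forall e, 0 < c e -> t e \in A -> (h e \in A) || B e;
  barrier_comp : forall b e, 0 < c e -> t e \in X b ->
    [|| h e \in X b, h e \in A | sv (h e) \in A] }.

Lemma barrier_exists : exists A B X, barrier A B X.
Proof.
exists [set v | inA v], gate, comp; split.
- by rewrite inE; apply/asboolP; split; [exact: reach_s|].
- by move=> v; rewrite !inE => /asboolP[rv _]; apply/asboolPn; rewrite svK => -[].
- exact: gate_cap.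
- by move=> b /and3P[_ + _]; rewrite inE.
- exact: comp_gate.
- exact: comp_sv.
- move=> b v; rewrite !inE => /andP[/asboolP[_ rv] _].
  by apply/asboolPn => -[].
- exact: comp_inj.
- move=> e ce; rewrite !inE => At; have rh := A_out At ce.
  rewrite /gate ce At /=; case: (EM (reach (sv (h e)))) => rh'.
    by apply/orP; right; apply/asboolP.
  by apply/orP; left; apply/asboolP.
- move=> b e ce tb; have /andP[/asboolP[[p rp] _] _] : inZ (t e) && connect adj (h b) (t e).
    by rewrite inE in tb.
  case: (boolP (inZ (h e))) => [zh|/asboolPn nzh].
    by rewrite (comp_step tb zh) //; exists e.
  rewrite !inE; case: (EM (reach (h e))) => rh.
    apply/or3P; apply: Or32; apply/asboolP; split => // rh'; exact: nzh.
  have [_ _ rh'] := reach_step rp ce rh.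
  by apply/or3P; apply: Or33; apply/asboolP; rewrite svK.
Qed.

End RegularReachability.

(** Regularity allows an arc to be repeated, but augmentation must use it at most once. The walk is
    shortened as a path whose vertices are the arcs. *)
Lemma walk_uniq (V E : finType) (t h : E -> V) x p y :
  walk t h x p y -> exists q, [/\ walk t h x q y, uniq q & {subset q <= p}].
Proof.
case: p => [|e p]; first by exists [::].
have wE e' p' : walk t h x (e' :: p') y =
    [&& t e' == x, path (fun a b => t b == h a) e' p' & h (last e' p') == y].
  rewrite /=; congr (_ && _).
  by elim: p' e' => //= a p' IH e'; rewrite IH andbA.
rewrite wE => /and3P[te pe he].
move: he; case/shortenP: pe => q pq uq sq he.
exists (e :: q); split => //; first by rewrite wE te pq he.
by move=> a; rewrite !inE => /orP[->//|/sq ->]; rewrite orbT.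
Qed.

Local Open Scope ring_scope.

Lemma netoutD (V E : finType) (tl hd : E -> V) (R : numDomainType) (f k : E -> R) v :
  netout tl hd (fun a => f a + k a) v = netout tl hd f v + netout tl hd k v.
Proof. by rewrite /netout !big_split /=; ring. Qed.

(** Summation by parts, from node potentials to arc coefficients. *)
Lemma sum_netout (V E : finType) (tl hd : E -> V) (R : numDomainType)
    (f : E -> R) (psi : V -> R) :
  \sum_v psi v * netout tl hd f v = \sum_a f a * (psi (tl a) - psi (hd a)).
Proof.
have key (k : E -> V) :
    \sum_v psi v * \sum_(a | k a == v) f a = \sum_a f a * psi (k a).
  under eq_bigr => v _ do rewrite big_distrr /=.
  rewrite (exchange_big_dep xpredT) //=; apply: eq_bigr => a _.
  by rewrite (big_pred1 (k a)) => [|v /=]; [rewrite mulrC | rewrite eq_sym].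
under eq_bigr => v _ do rewrite /netout mulrBr.
rewrite sumrB !key -sumrB; apply: eq_bigr => a _.
by rewrite mulrBr.
Qed.

(** * Residual network *)

Section Residual.

Variables (V E : finType) (tl hd : E -> V) (sv : V -> V) (se : E -> E).
Variables (u : E -> nat) (s : V) (g : E -> nat).
Hypothesis Hskew : skew_symmetric tl hd sv se.
Hypothesis Hu : sym_cap se u.
Hypothesis Hg : sym_cap se g.
Hypothesis gu : forall a, (g a <= u a)%N.

(* [(a, true)] is the arc [a], [(a, false)] is its reverse. *)
Definition res_tl (e : E * bool) := if e.2 then tl e.1 else hd e.1.
Definition res_hd (e : E * bool) := if e.2 then hd e.1 else tl e.1.
Definition res_se (e : E * bool) := (se e.1, e.2).
Definition res_cap (e : E * bool) := if e.2 then (u e.1 - g e.1)%N else g e.1.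

Lemma res_skew : skew_symmetric res_tl res_hd sv res_se.
Proof.
case: Hskew => sv_neq svK se_neq seK se_ends; split => //.
- by move=> [a d]; rewrite xpair_eqE negb_and se_neq.
- by move=> [a d]; rewrite /res_se /= seK.
- by move=> [a []]; have [] := se_ends a.
Qed.

Lemma res_sym : sym_cap res_se res_cap.
Proof. by move=> [a []]; rewrite /res_cap /= ?Hu ?Hg. Qed.

Definition pushed (p : seq (E * bool)) (a : E) : int :=
  (count_mem (a, true) p)%:Z - (count_mem (a, false) p)%:Z.

Lemma netout_pushed x p y v :
  walk res_tl res_hd x p y ->
  netout tl hd (pushed p) v = (x == v)%:R - (y == v)%:R.
Proof.
elim: p x => [|e p IH] x /=.
  by move/eqP->; rewrite subrr /netout !big1.
move=> /andP[/eqP<- /IH{}IH].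
have -> : netout tl hd (pushed (e :: p)) v =
    netout tl hd (fun a => (if e.2 then 1 else -1) * (e.1 == a)%:R + pushed p a) v.
  by congr (_ - _); apply: eq_bigr => a _; rewrite /pushed /=;
    case: e {IH} => a' [] /=; rewrite !xpair_eqE ?andbT ?andbF /=; lia.
rewrite netoutD {}IH.
have -> : netout tl hd (fun a => (if e.2 then 1 else -1) * (e.1 == a)%:R) v =
    (if e.2 then 1 else -1) * ((tl e.1 == v)%:R - (hd e.1 == v)%:R) :> int.
  have key (k : E -> V) : \sum_(a | k a == v) (if e.2 then 1 else -1) * (e.1 == a)%:R
      = (if e.2 then 1 else -1) * (k e.1 == v)%:R :> int.
    rewrite -big_distrr /=; congr (_ * _); rewrite big_mkcond (bigD1 e.1) //=.
    rewrite eqxx big1 ?addr0; first by case: eqP.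
    by move=> a; rewrite eq_sym => /negPf->; case: ifP.
  by rewrite /netout !key mulrBr.
by case: e => a [] /=; rewrite /res_tl /res_hd /=; ring.
Qed.

Lemma augment p :
  is_flow tl hd sv u s (fun a => (g a)%:Z) ->
  rwalk res_tl res_hd res_se res_cap s p (sv s) ->
  exists2 g', is_ISflow tl hd sv se u s g' &
    netout tl hd g' s = netout tl hd (fun a => (g a)%:Z) s + 2.
Proof.
case: Hskew => sv_neq svK se_neq seK se_ends.
move=> [_ cons] /andP[/walk_uniq[q [wq uq sq]] rp].
have rq : regular res_se res_cap q := regular_sub sq rp.
have wq' := walk_dual res_skew wq; rewrite svK in wq'.
set q' := dual_walk res_se q in wq'.
(* If [e] is on both walks, then [e] and its mate are on [q], and regularity gives capacity at least
   2. *)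
have cq e : (count_mem e q + count_mem e q' <= res_cap e)%N.
  have uq' : uniq q'.
    rewrite rev_uniq map_inj_uniq //; case: res_skew => _ _ _ rK _.
    exact: inv_inj.
  rewrite !count_uniq_mem // (mem_dual res_skew).
  case: (boolP (e \in q)) => [/(allP rq)|_]; first by case: (_ \in _).
  case: (boolP (_ \in q)) => // /(allP rq); rewrite res_sym.
  by case: (res_cap e).
have q'E e : count_mem e q' = count_mem (res_se e) q.
  rewrite count_rev count_map; apply: eq_count => a /=.
  case: res_skew => _ _ _ rK _.
  by rewrite -{1}(rK e) (inj_eq (inv_inj rK)).
have netE v : netout tl hd (fun a => (g a)%:Z + pushed q a + pushed q' a) v =
    netout tl hd (fun a => (g a)%:Z) v + ((s == v)%:R - (sv s == v)%:R) *+ 2.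
  rewrite (netoutD tl hd _ (pushed q')) (netoutD tl hd _ (pushed q)).
  by rewrite (netout_pushed _ wq) (netout_pushed _ wq') mulr2n -addrA.
exists (fun a => ((g a)%:Z + pushed q a) + pushed q' a).
  split.
    move=> a; rewrite Hg /pushed !q'E /res_se /= seK; lia.
  split.
    move=> a; have := cq (a, true); have := cq (a, false).
    have := gu a; rewrite /res_cap /pushed /= natz.
    move: (count_mem (a, true) q) (count_mem (a, false) q) => m1 m2.
    move: (count_mem (a, true) q') (count_mem (a, false) q') => m3 m4.
    move: (u a) (g a) => ua ga; lia.
  move=> v vs vs'; rewrite netE cons // ![_ == v]eq_sym.
  by rewrite (negPf vs) (negPf vs') subrr.
by rewrite netE eqxx (negPf (sv_neq s)).
Qed.

End Residual.

(** * Odd fragments and complementary slackness *)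

(** The involution exchanges the elements ranked before their image with those ranked after it, so
    the two halves of the sum agree. *)
Lemma sum_involution_even (T : finType) (i : T -> T) (P : pred T) (F : T -> nat) :
  (forall x, i x != x) -> involutive i -> (forall x, P (i x) = P x) ->
  (forall x, P x -> F (i x) = F x) -> ~~ odd (\sum_(x | P x) F x)%N.
Proof.
move=> i_neq iK Pi Fi.
rewrite (bigID (fun x => enum_rank x < enum_rank (i x))%N) /=.
rewrite [X in (_ + X)%N](reindex_inj (inv_inj iK)) /=.
rewrite [X in (_ + X)%N](_ : _ =
  \sum_(x | P x && (enum_rank x < enum_rank (i x))%N) F x)%N.
  by rewrite oddD addbb.
apply: eq_big => [x|x /andP[]]; last by rewrite Pi => /Fi.
rewrite Pi iK -leqNgt leq_eqVlt; case: eqP => // /ord_inj /enum_rank_inj xi.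
by have := i_neq x; rewrite -xi eqxx.
Qed.

Section Fragments.

Variables (V E : finType) (tl hd : E -> V) (sv : V -> V) (se : E -> E).
Hypothesis Hskew : skew_symmetric tl hd sv se.
Variable X : {set V}.
Hypothesis HX : forall v, (sv v \in X) = (v \in X).

Let seK : involutive se. Proof. by case: Hskew. Qed.
Let tl_se a : tl (se a) = sv (hd a).
Proof. by case: Hskew => _ _ _ _ /(_ a) []. Qed.
Let hd_se a : hd (se a) = sv (tl a).
Proof. by case: Hskew => _ _ _ _ /(_ a) []. Qed.

Definition entering a := (hd a \in X) && (tl a \notin X).

(** By symmetry and conservation, mates in [X] have equal inflow, so the total inflow of the nodes
    of [X] is even. Arcs inside [X] pair up with their mates, so removing them keeps the parity. *)
Lemma inflow_even (g : E -> nat) :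
  sym_cap se g ->
  (forall v, v \in X -> \sum_(a | tl a == v) g a = \sum_(a | hd a == v) g a)%N ->
  ~~ odd (\sum_(a | entering a) g a)%N.
Proof.
case: Hskew => sv_neq svK se_neq _ _ Hg cons.
have all_even : ~~ odd (\sum_(a | hd a \in X) g a)%N.
  rewrite (partition_big hd (mem X)) //=.
  rewrite (eq_bigr (fun v => \sum_(a | hd a == v) g a)%N); last first.
    by move=> v vX; apply: eq_bigl => a; case: eqP => [->|]; rewrite ?andbF ?vX.
  apply: (@sum_involution_even _ sv) => // v vX.
  rewrite -[RHS]cons // (reindex_inj (inv_inj seK)) /=.
  by apply: eq_big => a; rewrite ?Hg // hd_se (inj_eq (inv_inj svK)).
have in_even : ~~ odd (\sum_(a | (hd a \in X) && (tl a \in X)) g a)%N.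
  apply: (@sum_involution_even _ se) => // a.
  by rewrite tl_se hd_se !HX andbC.
by move: all_even; rewrite (bigID (fun a => tl a \in X)) oddD (negPf in_even).
Qed.

Variable U : {set E}.
Hypothesis HU : forall a, a \in U -> entering a.

Lemma mem_dual_set a : (a \in se @: U) = (se a \in U).
Proof. by rewrite -{1}(seK a) mem_imset //; exact: inv_inj. Qed.

(** [chi] is the sum of a function supported on the arcs entering [X] and of its transport by [se];
    a symmetric [f] weighs both equally. *)
Lemma sum_chi (R : numDomainType) (f : E -> R) :
  (forall a, f (se a) = f a) ->
  \sum_a f a * (chi tl hd se X U a)%:~R =
  2 * (\sum_(a in U) f a - \sum_(a | entering a && (a \notin U)) f a).
Proof.
move=> Hf; pose chi1 a : R := if entering a then (if a \in U then 1 else -1) else 0.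
have chiE a : (chi tl hd se X U a)%:~R = chi1 a + chi1 (se a).
  rewrite /chi /chi1 inE mem_dual_set; have := HU (a := a); have := HU (a := se a).
  rewrite /entering tl_se hd_se !HX.
  case: (a \in U); case: (se a \in U); case: (hd a \in X); case: (tl a \in X) => //=;
    do ?[by move=> /(_ isT)]; do ?[by move=> _ /(_ isT)]; by rewrite ?addr0 ?add0r.
under eq_bigr => a _ do rewrite chiE mulrDr.
rewrite big_split /= [X in _ + X](reindex_inj (inv_inj seK)) /=.
under [X in _ + X]eq_bigr => a _ do rewrite seK Hf.
rewrite mulr_natl -mulr2n; congr (_ *+ 2).
rewrite (bigID (fun a => a \in U)) /= -sumrN; congr (_ + _).
  by apply: eq_bigr => a aU; rewrite /chi1 HU // aU mulr1.
rewrite big_mkcond [RHS]big_mkcond; apply: eq_bigr => a _.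
by rewrite /chi1; case: (entering a); case: (a \in U); rewrite ?mulr0 ?mulrN1.
Qed.

End Fragments.

(** * Fragment constraints for IS-flows, and the barrier certificate *)

Section Optimality.

Variables (V E : finType) (tl hd : E -> V) (sv : V -> V) (se : E -> E).
Variables (u : E -> nat) (s : V) (g : E -> nat).
Hypothesis Hskew : skew_symmetric tl hd sv se.
Hypothesis Hu : sym_cap se u.
Hypothesis Hg : sym_cap se g.
Hypothesis gu : forall a, (g a <= u a)%N.
Hypothesis cons : forall v, v != s -> v != sv s ->
  (\sum_(a | tl a == v) g a = \sum_(a | hd a == v) g a)%N.

Let sv_neq v : sv v != v. Proof. by case: Hskew. Qed.
Let svK : involutive sv. Proof. by case: Hskew. Qed.
Let seK : involutive se. Proof. by case: Hskew. Qed.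
Let tl_se a : tl (se a) = sv (hd a).
Proof. by case: Hskew => _ _ _ _ /(_ a) []. Qed.
Let hd_se a : hd (se a) = sv (tl a).
Proof. by case: Hskew => _ _ _ _ /(_ a) []. Qed.

Lemma entering_even (X : {set V}) :
  (forall v, (sv v \in X) = (v \in X)) -> s \notin X ->
  ~~ odd (\sum_(a | entering tl hd X a) g a)%N.
Proof.
move=> HX sX; apply: (inflow_even Hskew) => // v vX; apply: cons.
  by apply: contraNneq sX => <-.
by apply: contraNneq sX => vs; rewrite -HX -vs.
Qed.

Lemma entering_split (X : {set V}) (U : {set E}) (F : E -> nat) :
  (forall a, a \in U -> entering tl hd X a) ->
  (\sum_(a | entering tl hd X a) F a = \sum_(a in U) F a +
    \sum_(a | entering tl hd X a && (a \notin U)) F a)%N.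
Proof.
move=> HU; rewrite (bigID (fun a => a \in U)) /=; congr (_ + _)%N.
by apply: eq_bigl => a; case: (boolP (a \in U)) => [/HU ->|]; rewrite ?andbF.
Qed.

Lemma capS_residual (U : {set E}) :
  (capS u U = \sum_(a in U) (u a - g a) + \sum_(a in U) g a)%N.
Proof. by rewrite -big_split; apply: eq_bigr => a _; rewrite /= subnK. Qed.

(** Failure would force [g] to saturate [U] and to vanish on the other entering arcs; the inflow of
    [X] would be the odd number [capS u U], against [entering_even]. *)
Lemma ISflow_fragment (R : numDomainType) (X : {set V}) (U : {set E}) :
  odd_fragment tl hd sv u s X U ->
  \sum_a (g a)%:R * (chi tl hd se X U a)%:~R <= 2 * (capS u U)%:R - 2 :> R.
Proof.
case=> imX sX HU oddU.
have HX v : (sv v \in X) = (v \in X).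
  by rewrite -{1}imX mem_imset //; exact: inv_inj.
rewrite (sum_chi Hskew) //; last by move=> a; rewrite Hg.
have := entering_even HX sX; rewrite (entering_split _ HU).
rewrite -!natr_sum; set gU := (\sum_(a in U) g a)%N; set gO := (\sum_(a | _) g a)%N.
move=> even_g; have leU : (gU <= capS u U)%N by apply: leq_sum.
have le1 : (gU + 1 <= capS u U + gO)%N.
  rewrite addn1 ltn_neqAle (leq_trans leU (leq_addr _ _)) andbT.
  apply: contraNneq even_g => eqU.
  have /eqP gO0 : gO == 0%N by rewrite -leqn0 -(leq_add2l (capS u U)) -eqU addn0.
  by rewrite gO0 addn0 eqU gO0 addn0.
move: le1; rewrite -(ler_nat R) !natrD => le1.
rewrite -{3}[2]mulr1 -mulrBr ler_wpM2l // lerBlDr -addrA [- _ + _]addrC addrA.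
by rewrite lerBrDr.
Qed.

Section Barrier.

Let c := res_cap u g.
Let t := res_tl tl hd.
Let h := res_hd tl hd.
Variables (A : {set V}) (B : pred (E * bool)) (X : E * bool -> {set V}).
Let c_se e : c (res_se se e) = c e. Proof. exact: res_sym. Qed.
Let t_se e : t (res_se se e) = sv (h e).
Proof. by have [_ _ _ _ /(_ e) []] := res_skew Hskew. Qed.
Let h_se e : h (res_se se e) = sv (t e).
Proof. by have [_ _ _ _ /(_ e) []] := res_skew Hskew. Qed.

Hypothesis HB : barrier t h sv c s A B X.

Definition fragment_arcs b := [set a | (tl a \in A) && (hd a \in X b)].

Lemma fragment_entering b a : a \in fragment_arcs b -> entering tl hd (X b) a.
Proof.
rewrite inE /entering => /andP[ta ->]; apply/negP => tX.
by have := barrier_disj HB tX; rewrite ta.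
Qed.

Lemma s_notin_comp b : s \notin X b.
Proof. by apply/negP => /(barrier_disj HB); rewrite (barrier_s HB). Qed.

(* The residual arcs from [A] to [X b] have total capacity 1: [b] is the only
   one, and those which are not forward arcs are counted at the mates of the
   arcs of the network that enter [X b] from the dual of [A]. *)
Lemma fragment_residual b : B b ->
  (\sum_(a in fragment_arcs b) (u a - g a) +
   \sum_(a | entering tl hd (X b) a && (a \notin fragment_arcs b)) g a = 1)%N.
Proof.
move=> Bb; pose eta a := if tl a \in A then (a, true) else (se a, false).
have cb := barrier_cap HB Bb; have tb := barrier_tail HB Bb.
have hb := barrier_head HB Bb.
have -> : (\sum_(a in fragment_arcs b) (u a - g a) +
   \sum_(a | entering tl hd (X b) a && (a \notin fragment_arcs b)) g a =
   \sum_(a | entering tl hd (X b) a) c (eta a))%N.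
  rewrite (entering_split _ (@fragment_entering b)); congr (_ + _)%N.
    by apply: eq_bigr => a; rewrite inE /eta => /andP[-> _].
  apply: eq_bigr => a /andP[/andP[ha _]]; rewrite inE ha andbT /eta => /negPf ->.
  by rewrite /c /res_cap /= Hg.
pose a0 := if b.2 then b.1 else se b.1.
have [ent0 eta0] : entering tl hd (X b) a0 /\ eta a0 = b.
  rewrite /entering /eta /a0; case: (b) tb hb => a [] /=; rewrite /t /h /res_tl /res_hd /=.
    move=> ta ha; rewrite ta ha; split => //=; apply/negP => /(barrier_disj HB).
    by rewrite ta.
  move=> ha ta; rewrite hd_se tl_se !(barrier_sv HB) ta seK.
  rewrite (negPf (barrier_dual HB ha)); split => //=; apply/negP => /(barrier_disj HB).
  by rewrite ha.
rewrite (bigD1 a0) //= eta0 cb big1 // => a /andP[/andP[ha ta] na0].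
(* Positive capacity forces [eta a] to go from [A] to [X b]; it is then in [B], hence equal to [b],
   and [a] is [a0]. *)
apply/eqP; rewrite -leqn0 leqNgt; apply: contra na0 => ca.
have [tA hX] : t (eta a) \in A /\ h (eta a) \in X b.
  rewrite /eta in ca *; case: ifP ca => [//|nta].
  rewrite /c /res_cap /= Hg => ga.
  have := @barrier_comp _ _ _ _ _ _ _ _ _ _ HB b (a, false) ga ha.
  rewrite /h /t /res_hd /res_tl /= (negPf ta) nta /= => tA.
  by rewrite hd_se tl_se (barrier_sv HB).
have := barrier_out HB ca tA; rewrite (negPf (barrier_disj HB hX)) /= => Be.
have etab := barrier_inj HB Be Bb (barrier_head HB Be) hX.
by rewrite /a0 -etab /eta; case: (tl a \in A); rewrite /= ?seK.
Qed.

Lemma barrier_fragment b : B b -> odd_fragment tl hd sv u s (X b) (fragment_arcs b).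
Proof.
move=> Bb; split.
- apply/setP => v; apply/imsetP/idP => [[w wX ->]|vX]; first by rewrite (barrier_sv HB).
  by exists (sv v); rewrite ?svK ?(barrier_sv HB).
- exact: s_notin_comp.
- exact: fragment_entering.
(* Modulo 2, [g] agrees on the fragment arcs and on the other entering arcs, so [capS] has the
   parity of the sum in [fragment_residual], which is 1. *)
have := entering_even (barrier_sv HB b) (s_notin_comp b).
rewrite (entering_split _ (@fragment_entering b)).
have := fragment_residual Bb; rewrite capS_residual; lia.
Qed.

Lemma barrier_fragment_tight (R : numDomainType) b : B b ->
  \sum_a (g a)%:R * (chi tl hd se (X b) (fragment_arcs b) a)%:~R =
  2 * (capS u (fragment_arcs b))%:R - 2 :> R.
Proof.
move=> Bb; rewrite (sum_chi Hskew) //; first last.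
- by move=> a; rewrite Hg.
- exact: fragment_entering.
- exact: (barrier_sv HB).
rewrite -!natr_sum; have := fragment_residual Bb.
rewrite capS_residual natrD => /(congr1 (fun n => n%:R : R)); rewrite natrD mulr1n => r1.
by rewrite (canRL (addrK _) r1); ring.
Qed.

(** * Complementary slackness *)

Section Slackness.

Variable R : numDomainType.

Let side v : R := (v \in A)%:R - (sv v \in A)%:R.
Let covered v : R := [exists b, B b && (v \in X b)]%:R.

Lemma covered_sum v : covered v = \sum_(b | B b) (v \in X b)%:R.
Proof.
rewrite /covered; case: existsP => [[b /andP[Bb vb]]|nv].
  rewrite (bigD1 b) //= vb big1 ?addr0 // => b' /andP[Bb' nb].
  apply/eqP; rewrite pnatr_eq0 eqb0; apply: contra nb => vb'.
  by apply/eqP; apply: (barrier_inj HB Bb' Bb vb' vb).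
rewrite big1 // => b Bb; apply/eqP; rewrite pnatr_eq0 eqb0.
by apply/negP => vb; apply: nv; exists b; rewrite Bb.
Qed.

(* [side] vanishes on [X b], and the arcs of positive capacity that leave [X b]
   end in [A] or in its dual. *)
Lemma chi_potential b a : (0 < u a)%N ->
  (chi tl hd se (X b) (fragment_arcs b) a)%:~R =
  (hd a \in X b)%:R * side (tl a) - (tl a \in X b)%:R * side (hd a).
Proof.
move=> ua; rewrite /chi inE (mem_dual_set Hskew) !inE tl_se hd_se (barrier_sv HB) /side.
have HD v : v \in X b -> (v \in A = false) /\ (sv v \in A = false).
  move=> vX; split; apply/negbTE; first exact: (barrier_disj HB vX).
  by apply: (barrier_disj HB (b := b)); rewrite (barrier_sv HB).
have HA v : v \in A -> sv v \in A = false by move/(barrier_dual HB)/negbTE.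
have [] : (tl a \in X b -> [|| hd a \in X b, hd a \in A | sv (hd a) \in A]) /\
          (hd a \in X b -> [|| tl a \in X b, tl a \in A | sv (tl a) \in A]).
  have ends e : (0 < c e)%N ->
      (t e \in X b -> [|| h e \in X b, h e \in A | sv (h e) \in A]) /\
      (h e \in X b -> [|| t e \in X b, t e \in A | sv (t e) \in A]).
    move=> ce; split; first exact: (barrier_comp HB).
    have := barrier_comp HB (b := b) (e := res_se se e).
    rewrite c_se t_se h_se => /(_ ce).
    by rewrite !(barrier_sv HB) svK [(sv _ \in A) || _]orbC.
  (* As [u a > 0], the forward or the reverse residual arc of [a] has positive capacity. *)
  case: (posnP (g a)) => [ga|ga]; last by have [] := ends (a, false) ga.
  by apply: (ends (a, true)); rewrite /c /res_cap /= ga subn0.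
have := HD (tl a); have := HD (hd a); have := HA (tl a); have := HA (hd a).
case: (tl a \in X b); case: (hd a \in X b) => //=;
  case: (tl a \in A); case: (hd a \in A) => //=;
  case: (sv (tl a) \in A); case: (sv (hd a) \in A) => //= P1 P2 P3 P4 P5 P6;
  do ?[by case: (P1 isT)]; do ?[by case: (P2 isT)];
  do ?[by case: (P3 isT)]; do ?[by case: (P4 isT)];
  do ?[by have := P5 isT]; do ?[by have := P6 isT];
  rewrite /=; ring.
Qed.

(** [side] can decrease along [e] only if [e] leaves [A] or enters its dual. Then [e] or its mate is
    in [B], and the end of [e] outside [A] and its dual is covered, which makes both sides
    vanish. *)
Lemma residual_slack e : (0 < c e)%N ->
  side (t e) * (1 - covered (h e)) <= side (h e) * (1 - covered (t e)).
Proof.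
move=> ce.
have cov1 b v : B b -> v \in X b -> covered v = 1.
  move=> Bb vX; rewrite /covered; case: existsP => // -[].
  by exists b; rewrite Bb.
have cov0 v : (v \in A) || (sv v \in A) -> covered v = 0.
  move=> vA; rewrite /covered; case: existsP => // -[b /andP[_ vX]].
  move: vA; rewrite (negPf (barrier_disj HB vX)).
  by rewrite (negPf (barrier_disj HB (b := b) _)) // (barrier_sv HB).
have side0 b v : v \in X b -> side v = 0.
  move=> vX; rewrite /side (negPf (barrier_disj HB vX)).
  by rewrite (negPf (barrier_disj HB (b := b) _)) ?(barrier_sv HB) // subrr.
have sideA v : v \in A -> side v = 1.
  by move=> vA; rewrite /side vA (negPf (barrier_dual HB vA)) subr0.
have sideA' v : sv v \in A -> side v = -1.
  move=> vA; rewrite /side vA; have := barrier_dual HB vA; rewrite svK => /negPf ->.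
  by rewrite sub0r.
have side00 v : v \notin A -> sv v \notin A -> side v = 0.
  by rewrite /side => /negPf -> /negPf ->; rewrite subrr.
have cov_le v : 0 <= 1 - covered v by rewrite subr_ge0 /covered lern1 leq_b1.
case: (boolP (t e \in A)) => [tA|tA].
  rewrite (sideA _ tA) (cov0 (t e)) ?tA // mul1r subr0 mulr1.
  case/orP: (barrier_out HB ce tA) => [hA|Be].
    by rewrite (sideA _ hA) cov0 ?hA // subr0.
  have hX := barrier_head HB Be.
  by rewrite (side0 _ _ hX) (cov1 _ _ Be hX) subrr.
case: (boolP (sv (t e) \in A)) => [tA'|tA'].
  rewrite (sideA' _ tA') (cov0 (t e)) ?tA' ?orbT // mulN1r subr0 mulr1.
  case: (boolP (h e \in A)) => [hA|hA].
    by rewrite (sideA _ hA) (le_trans (y := 0)) // oppr_le0.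
  case: (boolP (sv (h e) \in A)) => [hA'|hA'].
    by rewrite (sideA' _ hA') cov0 ?hA' ?orbT // subr0.
  by rewrite side00 // oppr_le0.
rewrite side00 // mul0r.
case: (boolP (h e \in A)) => [hA|hA]; first by rewrite (sideA _ hA) mul1r.
case: (boolP (sv (h e) \in A)) => [hA'|hA']; last by rewrite side00 // mul0r.
have := barrier_out HB (e := res_se se e).
rewrite c_se t_se h_se (negPf tA') => /(_ ce hA') /= Be.
have := barrier_head HB Be; rewrite h_se (barrier_sv HB) => tX.
by rewrite (cov1 _ _ Be tX) subrr mulr0.
Qed.

(** Both sides split into a [slack] part and a fragment part. The latter is tight at [g]; the former
    is compared arc by arc, as positive slack forces [g a = u a] and negative slack forces
    [g a = 0]. *)
Lemma barrier_bound (f : E -> R) :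
  (forall a, 0 <= f a <= (u a)%:R) ->
  (forall b, B b -> \sum_a f a * (chi tl hd se (X b) (fragment_arcs b) a)%:~R
     <= 2 * (capS u (fragment_arcs b))%:R - 2) ->
  \sum_a f a * (side (tl a) - side (hd a)) <=
  \sum_a (g a)%:R * (side (tl a) - side (hd a)).
Proof.
move=> Hf Hfr.
pose slack a := side (tl a) * (1 - covered (hd a)) - side (hd a) * (1 - covered (tl a)).
(* [chi_potential] needs [u a > 0]; arcs of capacity 0 contribute nothing because [k] vanishes
   there. *)
have key (k : E -> R) : (forall a, u a = 0%N -> k a = 0) ->
    \sum_a k a * (side (tl a) - side (hd a)) = \sum_a k a * slack a +
    \sum_(b | B b) \sum_a k a * (chi tl hd se (X b) (fragment_arcs b) a)%:~R.
  move=> k0; rewrite exchange_big /= -big_split /=; apply: eq_bigr => a _.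
  have [/k0 ->|ua] := posnP (u a).
    by rewrite !mul0r add0r big1 // => b _; rewrite mul0r.
  rewrite -big_distrr -mulrDr; congr (_ * _).
  under eq_bigr => b _ do rewrite (chi_potential _ ua).
  rewrite sumrB -!mulr_suml -!covered_sum /slack; ring.
rewrite !key; first last.
- move=> a ua; have := Hf a; rewrite ua => fa; apply: le_anti; by rewrite andbC.
- by move=> a ua; have := gu a; rewrite ua leqn0 => /eqP ->.
apply: lerD; last first.
  apply: ler_sum => b Bb; rewrite barrier_fragment_tight //; exact: Hfr.
apply: ler_sum => a _; have /andP[f0 fu] := Hf a.
have slackF : (g a < u a)%N -> slack a <= 0.
  move=> lt_gu; rewrite subr_le0; apply: (residual_slack (e := (a, true))).
  by rewrite /c /res_cap /= subn_gt0.
have slackB : (0 < g a)%N -> 0 <= slack a.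
  by move=> ga; rewrite subr_ge0; apply: (residual_slack (e := (a, false))).
have [gua|lt_gu] := eqVneq (g a) (u a); last first.
  have {}lt_gu : (g a < u a)%N by rewrite ltn_neqAle lt_gu gu.
  have [ga|ga] := posnP (g a).
    by rewrite ga mul0r mulr_ge0_le0 // slackF.
  by rewrite (le_anti (x := slack a) (y := 0)) ?mulr0 // slackF // slackB.
have [ga|ga] := posnP (g a); last by rewrite gua ler_wpM2r // slackB.
have -> : f a = 0 by apply: le_anti; rewrite f0 andbT (le_trans fu) // -gua ga.
by rewrite mul0r ga mul0r.
Qed.

End Slackness.

End Barrier.
End Optimality.

Lemma flow_value (V E : finType) (tl hd : E -> V) (sv : V -> V) (u : E -> nat)
    (s : V) (R : numDomainType) (f : E -> R) (A : {set V}) :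
  involutive sv -> sv s != s -> (forall a, hd a != s) ->
  s \in A -> (forall v, v \in A -> sv v \notin A) ->
  is_flow tl hd sv u s f ->
  \sum_a f a * (((tl a \in A)%:R - (sv (tl a) \in A)%:R) -
                ((hd a \in A)%:R - (sv (hd a) \in A)%:R)) = LP_obj tl s f *+ 2.
Proof.
move=> svK s's Hs sA HA [_ cons].
have two (psi : V -> R) : \sum_v psi v * netout tl hd f v =
    psi s * netout tl hd f s + psi (sv s) * netout tl hd f (sv s).
  rewrite (bigD1 s) //= (bigD1 (sv s)) //= big1 ?addr0 // => v /andP[vs vs'].
  by rewrite cons // mulr0.
(* The constant potential shows that the net outflow at [sv s] is the opposite of that at [s]; the
   potential of [A] then counts the value twice. *)
have := two (fun=> 1); rewrite sum_netout subrr.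
under eq_bigr => a _ do rewrite mulr0.
rewrite big1 // !mul1r => /esym/eqP; rewrite addrC addr_eq0 => /eqP s'E.
rewrite -(sum_netout tl hd f (fun v => (v \in A)%:R - (sv v \in A)%:R)) two s'E.
rewrite svK sA (negPf (HA _ sA)) subr0 sub0r mul1r mulrNN mul1r -mulr2n.
by rewrite /netout [X in _ - X]big1 ?subr0 // => a; rewrite (negPf (Hs a)).
Qed.

Lemma max_ISflow_optimal (R : numDomainType) (V E : finType) (tl hd : E -> V)
    (sv : V -> V) (se : E -> E) (u : E -> nat) (s : V) (g : E -> nat) :
  skew_symmetric tl hd sv se -> sym_cap se u -> (forall a, hd a != s) ->
  is_max_ISflow tl hd sv se u s (fun a => (g a)%:Z) ->
  LP_feasible tl hd sv se u s (fun a => (g a)%:R : R) /\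
  forall f : E -> R, LP_feasible tl hd sv se u s f ->
    LP_obj tl s f <= LP_obj tl s (fun a => (g a)%:R : R).
Proof.
move=> Hskew Hu Hs [[sym_g flow_g] max_g].
have [sv_neq svK _ _ _] := Hskew.
have Hg : sym_cap se g by move=> a; have [] := sym_g a.
have [bounds_g cons_g] := flow_g.
have gu a : (g a <= u a)%N by have := bounds_g a; rewrite natz lez_nat.
have cons v : v != s -> v != sv s ->
    (\sum_(a | tl a == v) g a = \sum_(a | hd a == v) g a)%N.
  move=> vs vs'; have /eqP := cons_g v vs vs'.
  by rewrite /netout subr_eq0 -!(big_morph Posz PoszD (erefl _)) => /eqP[].
have flow_gR : is_flow tl hd sv u s (fun a => (g a)%:R : R).
  split=> [a|v vs vs']; first by rewrite ler0n ler_nat gu.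
  by rewrite /netout -!natr_sum cons // subrr.
have feas_g : LP_feasible tl hd sv se u s (fun a => (g a)%:R : R).
  split=> // X U; exact: ISflow_fragment.
split=> // f [flow_f frag_f].
have no_aug : ~ reach (res_tl tl hd) (res_hd tl hd) (res_se se) (res_cap u g) s (sv s).
  move=> [p rp]; have [g' /max_g + g'E] := augment Hskew Hu Hg gu flow_g rp.
  by rewrite g'E gerDl.
have [A [B [X HB]]] := barrier_exists (res_skew Hskew) (res_sym Hu Hg) no_aug.
have [bounds_f _] := flow_f.
have := barrier_bound Hskew Hu Hg gu HB bounds_f.
have value := flow_value svK (sv_neq s) Hs (barrier_s HB) (barrier_dual HB).
rewrite (value _ _ _ _ flow_f) (value _ _ _ _ flow_gR) ler_pMn2r //; apply => b Bb.
by apply: frag_f; exact: (barrier_fragment Hskew Hg gu cons HB Bb).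
Qed.

Theorem mainTheorem7 (R : realType) (V E : finType) (tl hd : E -> V)
    (sv : V -> V) (se : E -> E) (u : E -> nat) (s : V)
    (Hskew : skew_symmetric tl hd sv se) (Hu : sym_cap se u)
    (Hs : forall a, hd a != s)
    (g : E -> int) (Hg : is_max_ISflow tl hd sv se u s g) :
  LP_feasible tl hd sv se u s (fun a => (g a)%:~R : R) /\
  forall f : E -> R, LP_feasible tl hd sv se u s f ->
    LP_obj tl s f <= LP_obj tl s (fun a => (g a)%:~R : R).
Proof.
(* A flow is nonnegative, so [g] may be taken with values in [nat], where the parity arguments are
   made. *)
have gE : g = fun a => (absz (g a))%:Z.
  apply: funext => a; rewrite gez0_abs //.
  by have [[_ [/(_ a)/andP[]]]] := Hg.
by move: Hg; rewrite gE => /(max_ISflow_optimal R Hskew Hu Hs).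
Qed.
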